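(* Let $\mathscr{T}$ be a finite rooted tree with root $\rho$, set of leaves $\mathscr{L}$ and $|\mathrm{ch}(\rho)|\ge2$, let $V_\lambda=\mathbb{C}^{d_\lambda}$ for $\lambda\in\mathscr{L}$, $W=\bigotimes_{\lambda\in\mathscr{L}}V_\lambda$, and let $\mathbf{r}=(r_v)_{v\in\mathscr{T}\setminus\{\rho\}}$ be an admissible rank sequence. Then the tree tensor network variety $\mathrm{TTN}_{\mathscr{T},\mathbf{V},\mathbf{r}}\subset\mathbb{P}(W)$ is equal to the image of the projective contraction map $\Phi_{\mathscr{T},\mathbf{V},\mathbf{r}}$.
   Context: Tree: $\mathscr{T}$ is a finite rooted tree with root $\rho$ (also denoting its vertex set). $\mathrm{ch}(v)$ is the set of children of $v$. Leaves $\mathscr{L}$ are vertices without children; $\mathscr{N}=\mathscr{T}\setminus\mathscr{L}\ni\rho$. Internal nodes may have any number $\ge1$ of children, but $|\mathrm{ch}(\rho)|\ge2$. A rank sequence is a family $\mathbf{r}=(r_v)_{v\in\mathscr{T}\setminus\{\rho\}}$ of positive integers; $r_\rho:=1$. It is admissible if $r_\lambda\le d_\lambda$ for $\lambda\in\mathscr{L}$ and $r_v\le\prod_{u\in\mathrm{ch}(v)}r_u$ for $v\in\mathscr{N}\setminus\{\rho\}$. $\mathrm{TTN}_{\mathscr{T},\mathbf{V},\mathbf{r}}\subset\mathbb{P}(W)$ is the set of $[\psi]$ such that for each vertex $v\in\mathscr{T}$ there is a linear subspace $U_v$ with $\dim U_v\le r_v$ satisfying: $U_\lambda\subseteq V_\lambda$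 for $\lambda\in\mathscr{L}$; $U_v\subseteq\bigotimes_{u\in\mathrm{ch}(v)}U_u$ for $v\in\mathscr{N}$; and some representative $\psi$ of $[\psi]$ lies in $U_\rho$. Contraction map: put $E_v=\mathbb{C}^{r_v}$ for $v\ne\rho$. Local parameter spaces: $\mathcal{A}_\lambda=V_\lambda\otimes E_\lambda^*$ for $\lambda\in\mathscr{L}$; $\mathcal{A}_v=\big(\bigotimes_{u\in\mathrm{ch}(v)}E_u\big)\otimes E_v^*$ for $v\in\mathscr{N}\setminus\{\rho\}$; $\mathcal{A}_\rho=\bigotimes_{u\in\mathrm{ch}(\rho)}E_u$. The affine contraction map $\widehat{\Phi}_{\mathscr{T},\mathbf{V},\mathbf{r}}:\prod_{v\in\mathscr{T}}\mathcal{A}_v\to W$ sends $\mathbf{A}=(A^v)_{v\in\mathscr{T}}$ to the tensor with entries $$\big(\widehat{\Phi}_{\mathscr{T},\mathbf{V},\mathbf{r}}(\mathbf{A})\big)_{(j_\lambda)_{\lambda\in\mathscr{L}}}=\sum_{(\alpha_w)_{w\in\mathscr{T}\setminus\{\rho\}}}A^\rho_{(\alpha_u)_{u\in\mathrm{ch}(\rho)}}\prod_{v\in\mathscr{N}\setminus\{\rho\}}A^v_{(\alpha_u)_{u\in\mathrm{ch}(v)},\alpha_v}\prod_{\lambda\in\mathscr{L}}A^\lambda_{j_\lambda,\alpha_\lambda},$$ where $\alpha_w$ ranges over $\{1,\ldots,r_w\}$. Being linear in each $A^v$, it induces the rational map $\Phi_{\mathscr{T},\mathbf{V},\mathbf{r}}:\prod_{v\in\mathscr{T}}\mathbb{P}(\mathcal{A}_v)\dashrightarrow\mathbb{P}(W)$,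 $([A^v])_v\mapsto[\widehat{\Phi}_{\mathscr{T},\mathbf{V},\mathbf{r}}(\mathbf{A})]$, defined on the locus where the contraction is nonzero; its image is the set of values on that locus. *)

(* Defs.v *)
From HB Require Import structures.
From mathcomp Require Import all_boot all_order all_algebra.
From mathcomp Require Import complex.
From mathcomp Require Import boolp classical_sets reals.

Set Implicit Arguments.
Unset Strict Implicit.
Unset Printing Implicit Defensive.

Import GRing.Theory.
Local Open Scope ring_scope.
Local Open Scope classical_set_scope.

(* A finite rooted tree is given by its parent function, with the convention
   that the root is its own parent; its children are the other vertices mapped
   to it.  The root is required to have at least two children. *)
Definition children_of (V : finType) (root : V) (parent : V -> V) (v : V) :
    {set V} :=
  [set u | (u != root) && (parent u == v)]%SET.

Record rooted_tree := RootedTree {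
  vertex :> finType;
  root : vertex;
  parent : vertex -> vertex;
  parent_root : parent root = root;
  parent_reaches_root : forall v, exists n, iter n parent v = root;
  root_branching : (2 <= #|children_of root parent root|)%N
}.

Section Trees.
Variable T : rooted_tree.

Definition ch (v : T) : {set T} := children_of (root T) (@parent T) v.

Definition is_leaf (v : T) : bool := ch v == finset.set0.

Definition nonroot := {v : T | v != root T}.
Definition leaf := {v : T | is_leaf v}.
Definition inner := {v : nonroot | ~~ is_leaf (val v)}.
Definition child (v : T) := {u : nonroot | val u \in ch v}.

Lemma leaf_neq_root (l : leaf) : val l != root T.
Proof.
apply/eqP => l_root; have := valP l; rewrite l_root /is_leaf => /eqP ch0.
by have := root_branching T; rewrite -/(ch _) ch0 cards0.
Qed.

Definition leaf_nonroot (l : leaf) : nonroot :=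
  exist _ (val l) (leaf_neq_root l).

Definition descends (u v : T) : bool := fconnect (@parent T) u v.

Definition leaf_under (v : T) := {l : leaf | descends (val l) v}.

Lemma child_descends (v : T) (u : child v) (x : T) :
  descends x (val (val u)) -> descends x v.
Proof.
move=> xu; apply: (connect_trans xu); apply: connect1.
by have := valP u; rewrite inE => /andP[].
Qed.

Definition leaf_under_child (v : T) (u : child v)
    (l : leaf_under (val (val u))) : leaf_under v :=
  exist _ (val l) (child_descends (valP l)).

End Trees.

(* P(V) is the set of lines of V; the class of a nonzero vector x is <[x]>. *)
Definition projective (K : fieldType) (V : vectType K) :=
  {L : {vspace V} | \dim L == 1%N}.

(* The tensor product of the spaces K^(n_i) in coordinates, a tensor being the
   array of its entries, indexed by the set I of multi-indices. *)
Definition tensor (K : fieldType) (I : finType) : vectType K :=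
  {ffun I -> K^o}.

Section TensorNetwork.
Variables (K : fieldType) (T : rooted_tree).
Variables (d : leaf T -> nat) (r : nonroot T -> nat).

Definition rank (v : T) : nat := oapp r 1%N (insub v).

Definition admissible : Prop :=
  [/\ forall v, (0 < r v)%N,
      forall l : leaf T, (r (leaf_nonroot l) <= d l)%N
    & forall v : inner T,
        (r (val v) <= \prod_(u : child (val (val v))) r (val u))%N].

Definition leaf_index : finType := {dffun forall l : leaf T, 'I_(d l)}.
Definition W : vectType K := tensor K leaf_index.

Definition index_under (v : T) : finType :=
  {dffun forall l : leaf_under v, 'I_(d (val l))}.

(* The tensor product of the V_l over the leaves l at or below v: the ambient
   space of U_v.  For a leaf v it has the single factor V_v. *)
Definition W_under (v : T) : vectType K := tensor K (index_under v).

Definition restrict_child (v : T) (u : child v) (j : index_under v) :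
    index_under (val (val u)) :=
  finfun (fun l : leaf_under (val (val u)) => j (leaf_under_child l)).

Definition restrict (v : T) (j : leaf_index) : index_under v :=
  finfun (fun l : leaf_under v => j (val l)).

(* The canonical isomorphism identifying W_under (root T) with W. *)
Definition of_root (t : W_under (root T)) : W :=
  [ffun j => t (restrict (root T) j)].

Definition pure_tensor (v : T)
    (t : forall u : child v, W_under (val (val u))) : W_under v :=
  [ffun j => \prod_(u : child v) t u (restrict_child u j)].

(* Membership in the tensor product of the subspaces U_u, u in ch(v). *)
Definition in_tensor_product (U : forall v : T, {vspace W_under v}) (v : T)
    (w : W_under v) : Prop :=
  exists (n : nat) (t : 'I_n -> forall u : child v, W_under (val (val u))),
    (forall i u, t i u \in U (val (val u))) /\
    w = \sum_(i < n) pure_tensor (t i).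

Definition TTN : set (projective W) :=
  [set p | exists U : forall v : T, {vspace W_under v},
    [/\ forall v, (\dim (U v) <= rank v)%N,
        forall v, ~~ is_leaf v ->
          forall w, w \in U v -> in_tensor_product U w
      & exists psi : W, [/\ psi != 0, val p = <[psi]>%VS
          & exists2 t, t \in U (root T) & psi = of_root t]]].

Definition child_bonds (v : T) : finType :=
  {dffun forall u : child v, 'I_(r (val u))}.

Definition leaf_space (l : leaf T) : vectType K :=
  tensor K ('I_(d l) * 'I_(r (leaf_nonroot l)))%type.
Definition inner_space (v : inner T) : vectType K :=
  tensor K (child_bonds (val (val v)) * 'I_(r (val v)))%type.
Definition root_space : vectType K := tensor K (child_bonds (root T)).

(* The product over all vertices v of F(A_v), A_v being the local parameter
   space at v; T is the disjoint union of its leaves, its other nonroot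
   vertices and its root. *)
Record parameters (F : vectType K -> Type) := ParameterFamily {
  at_leaf : forall l : leaf T, F (leaf_space l);
  at_inner : forall v : inner T, F (inner_space v);
  at_root : F root_space
}.

Definition affine_parameters := parameters (fun V => V).
Definition projective_parameters := parameters (fun V => projective V).

Definition bonds : finType := {dffun forall w : nonroot T, 'I_(r w)}.

Definition restrict_bonds (v : T) (a : bonds) : child_bonds v :=
  finfun (fun u : child v => a (val u)).

Definition affine_contraction (A : affine_parameters) : W :=
  [ffun j : leaf_index =>
    \sum_(a : bonds)
      at_root A (restrict_bonds (root T) a)
      * (\prod_(v : inner T)
           at_inner A v (restrict_bonds (val (val v)) a, a (val v)))
      * (\prod_(l : leaf T) at_leaf A l (j l, a (leaf_nonroot l)))].

Definition represents (A : affine_parameters) (a : projective_parameters) :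
    Prop :=
  [/\ forall l, val (at_leaf a l) = <[at_leaf A l]>%VS,
      forall v, val (at_inner a v) = <[at_inner A v]>%VS
    & val (at_root a) = <[at_root A]>%VS].

Definition representative (a : projective_parameters) : affine_parameters :=
  ParameterFamily (F := fun V => V)
    (fun l => vpick (val (at_leaf a l)))
    (fun v => vpick (val (at_inner a v)))
    (vpick (val (at_root a))).

(* The rational map, undefined (None) where the contraction vanishes; it does
   not depend on the representatives, see contractionE. *)
Definition contraction (a : projective_parameters) : option (projective W) :=
  insub <[affine_contraction (representative a)]>%VS.

Lemma vpick_line (V : vectType K) (p : projective V) :
  val p = <[vpick (val p)]>%VS.
Proof.
apply/esym/eqP; rewrite eqEdim -memvE memv_pick /= (eqP (valP p)).
by rewrite dim_vline vpick0 -dimv_eq0 (eqP (valP p)).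
Qed.

Lemma representativeP (a : projective_parameters) :
  represents (representative a) a.
Proof. by split=> [l|v|]; apply: vpick_line. Qed.

Lemma line_eqP (V : vectType K) (x y : V) :
  <[x]>%VS = <[y]>%VS -> exists2 c : K, c != 0 & x = c *: y.
Proof.
move=> xy; have /vlineP[c xE] : x \in <[y]>%VS by rewrite -xy memv_line.
have [c0|c_neq0] := eqVneq c 0; last by exists c.
have x0 : x = 0 by rewrite xE c0 scale0r.
have /eqP y0 : y == 0.
  have := memv_line y; rewrite -xy x0 => /vlineP[k ->].
  by rewrite scaler0.
by exists 1; rewrite ?oner_neq0 // x0 y0 scaler0.
Qed.

Lemma line_scale (V : vectType K) (c : K) (x : V) :
  c != 0 -> <[c *: x]>%VS = <[x]>%VS.
Proof.
move=> c0; apply/eqP; rewrite eqEsubv -!memvE memvZ ?memv_line //=.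
by apply/vlineP; exists c^-1; rewrite scalerK.
Qed.

Lemma affine_contraction_scale (A B : affine_parameters)
    (cl : leaf T -> K) (ci : inner T -> K) (c : K) :
    (forall l, at_leaf A l = cl l *: at_leaf B l) ->
    (forall v, at_inner A v = ci v *: at_inner B v) ->
    at_root A = c *: at_root B ->
  affine_contraction A
  = (c * (\prod_v ci v) * (\prod_l cl l)) *: affine_contraction B.
Proof.
move=> Al Ai Ar.
have scaleE (I : finType) (k : K) (t : tensor K I) i : (k *: t) i = k * t i.
  by rewrite ffunE.
apply/ffunP => j; rewrite scaleE !ffunE mulr_sumr; apply: eq_bigr => a _.
rewrite Ar scaleE.
rewrite (eq_bigr _ (fun v _ => congr1 (fun t : inner_space v =>
  t (restrict_bonds (val (val v)) a, a (val v))) (Ai v))).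
rewrite (eq_bigr _ (fun l _ => congr1 (fun t : leaf_space l =>
  t (j l, a (leaf_nonroot l))) (Al l))).
rewrite (eq_bigr _ (fun v _ => scaleE _ (ci v) (at_inner B v) _)).
rewrite (eq_bigr _ (fun l _ => scaleE _ (cl l) (at_leaf B l) _)).
rewrite !big_split /=.
set x := \prod_v ci v; set y := \prod_l cl l.
set p := \prod_v _; set q := \prod_l _; set t := at_root B _.
by rewrite (mulrACA c t) -(mulrACA (c * x) y).
Qed.

Lemma contractionE (A : affine_parameters) (a : projective_parameters) :
  represents A a -> contraction a = insub <[affine_contraction A]>%VS.
Proof.
case=> Al Ai Ar; rewrite /contraction.
have [Bl Bi Br] := representativeP a; set B := representative a in Bl Bi Br *.
have /boolp.choice[cl cl_eq] (l : leaf T) :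
    exists c : K, c != 0 /\ at_leaf B l = c *: at_leaf A l.
  by have [|c ? ?] := @line_eqP _ (at_leaf B l) (at_leaf A l);
    [rewrite -Bl -Al | exists c].
have /boolp.choice[ci ci_eq] (v : inner T) :
    exists c : K, c != 0 /\ at_inner B v = c *: at_inner A v.
  by have [|c ? ?] := @line_eqP _ (at_inner B v) (at_inner A v);
    [rewrite -Bi -Ai | exists c].
have [|c c0 cE] := @line_eqP _ (at_root B) (at_root A); first by rewrite -Br -Ar.
rewrite (@affine_contraction_scale B A cl ci c) //.
- rewrite line_scale // !mulf_neq0 //; apply/prodf_neq0 => x _.
    by have [] := ci_eq x.
  by have [] := cl_eq x.
- by move=> l; have [] := cl_eq l.
- by move=> v; have [] := ci_eq v.
Qed.

Definition contraction_image : set (projective W) :=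
  [set p | exists a, contraction a = Some p].

End TensorNetwork.

Arguments TTN K {T} d r.
Arguments contraction_image K {T} d r.

(* Main.v *)
(* Write phi_v(x) for the contraction of the part of the network at or below v
   with the bond above v fixed to x.  These satisfy
     phi_v(x) = sum_c A^v(c, x) (tensor over u in ch(v) of phi_u(c_u)),
   and conversely any family satisfying this recursion computes the contraction
   at the root.  Given A, the spans U_v of the phi_v(x) witness that the
   contraction lies in the TTN variety; given subspaces U_v, taking for phi_v a
   spanning family of r_v vectors of U_v and expanding each phi_v(x) in the
   tensor products of the phi_u(c_u), by multilinearity, yields the A^v. *)

From Pilot Require Import Defs.
From mathcomp Require Import all_boot all_order all_algebra.
From mathcomp Require Import complex.
From mathcomp Require Import boolp classical_sets reals.
(* all_algebra shadows the root of a tree by poly.root. *)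
Import Pilot.Defs.

Set Implicit Arguments.
Unset Strict Implicit.
Unset Printing Implicit Defensive.

Import GRing.Theory.
Local Open Scope ring_scope.

(** * Distance to the root *)

Section Depth.
Variable T : rooted_tree.

Let reaches_root (v : T) : exists n, iter n (@parent T) v == root T.
Proof. by have [n nP] := parent_reaches_root v; exists n; apply/eqP. Qed.

Definition depth (v : T) : nat := ex_minn (reaches_root v).

Lemma in_ch (u v : T) : (u \in ch v) = (u != root T) && (parent u == v).
Proof. by rewrite inE. Qed.

(** Gives the order in which vertices are eliminated from the big sum, the measure for the recursion
    below, and the fact that no vertex is its own child. *)
Lemma depth_ch (u v : T) : u \in ch v -> depth u = (depth v).+1.
Proof.
rewrite in_ch => /andP[u_root /eqP <-]; rewrite /depth.
case: ex_minnP => -[|m] mP m_min; first by rewrite (negPf u_root) in mP.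
case: ex_minnP => n nP n_min; apply/eqP; rewrite eqSS eqn_leq.
by rewrite n_min -?iterSr // andbT -ltnS m_min // iterSr.
Qed.

End Depth.

(** * Summing a product of local weights over all bond assignments of a tree *)

Section TreeSum.
Variables (K : fieldType) (T : rooted_tree) (r : nonroot T -> nat).
Variables (g F : T -> bonds r -> K) (a0 : bonds r).

Definition agree_off (D : {set T}) (a b : bonds r) : bool :=
  [forall w : nonroot T, (val w \notin D) ==> (a w == b w)].

(** In the application [g v] is an entry of the tensor at [v] and [F v] an entry of the contraction
    at or below [v]. Both are functions of all bonds, which gives every vertex the same type of
    weight; locality records which bonds they see. *)
Hypothesis F_local : forall v (a b : bonds r),
  (forall w : nonroot T, val w = v -> a w = b w) -> F v a = F v b.
Hypothesis g_local : forall v (a b : bonds r),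
  (forall w : nonroot T, val w = v \/ val w \in ch v -> a w = b w) ->
  g v a = g v b.
Hypothesis F_rec : forall v a, F v a =
  \sum_(b : bonds r | agree_off (ch v) a b) g v b * \prod_(u in ch v) F u b.

Let pinned (w : T) (a : bonds r) : K :=
  if insub w is Some n then (a n == a0 n)%:R else 1.

(* S is the set of expanded vertices; below its boundary the bonds are pinned
   to a0, so that they contribute a single term to the sum. *)
Let factor (S : {set T}) (w : T) (a : bonds r) : K :=
  if w \in S then g w a
  else if (w == root T) || (parent w \in S) then F w a else pinned w a.

Let pinned_local w (a b : bonds r) :
  (forall n : nonroot T, val n = w -> a n = b n) -> pinned w a = pinned w b.
Proof. by move=> ab; rewrite /pinned; case: insubP => // n _ /ab ->. Qed.

Let pin (D : {set T}) (a : bonds r) : bonds r :=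
  [ffun w => if val w \in D then a0 w else a w].

(** The fixed points of [pin D] serve below as the representatives of the classes of assignments
    that agree off [D]. *)
Let prod_pinned (D : {set T}) a :
  root T \notin D -> \prod_(u in D) pinned u a = (pin D a == a)%:R.
Proof.
move=> rootD; have [/forallP pinE|/forallPn[n]] :=
  boolP [forall n, pin D a n == a n].
  have -> : pin D a = a by apply/ffunP => n; apply/eqP.
  rewrite eqxx; apply: big1 => u uD; rewrite /pinned; case: insubP => // n _ nE.
  by rewrite -(eqP (pinE n)) ffunE nE uD eqxx.
rewrite ffunE; case: ifP => [nD an|_]; last by rewrite eqxx.
rewrite (bigD1 (val n)) //= /pinned valK eq_sym (negPf an) mul0r.
by case: eqP => // /ffunP/(_ n); rewrite ffunE nD => /eqP; rewrite (negPf an).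
Qed.

(** With [v] expanded, summing over the bonds above its children turns [g v] times the product of
    the [F u] into [F v], by [F_rec]. With [v] removed, [F v] is already there and those bonds are
    pinned. No other factor sees them. *)
Let sum_factorD1 (S : {set T}) (v : T) :
    v \in S -> (forall w, w \in S -> parent w \in S) ->
    (forall u, u \in ch v -> u \notin S) ->
  \sum_a \prod_w factor S w a = \sum_a \prod_w factor (S :\ v) w a.
Proof.
move=> vS S_parent chS.
have rest_ch u : u \in ch v -> u != v by move=> /chS; apply: contraNneq => ->.
pose G a := \prod_(w | (w != v) && (w \notin ch v)) factor S w a.
have splitE f : \prod_w f w = f v * \prod_(u in ch v) f u *
    \prod_(w | (w != v) && (w \notin ch v)) f w :> K.
  rewrite (bigD1 v) //= (bigID (fun w => w \in ch v)) /= mulrA.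
  congr (_ * _ * _); apply: eq_bigl => u; rewrite andb_idl //.
  exact: rest_ch.
(* A vertex has only one parent, so the bonds above the children of [v] enter only the factors at
   [v] and at these children. *)
have G_local (a b : bonds r) : agree_off (ch v) a b -> G a = G b.
  move=> /forall_inP ab; apply: eq_bigr => w /andP[wv wch].
  have abw n : val n = w -> a n = b n by move=> nw; apply/eqP/ab; rewrite nw.
  rewrite /factor; case: ifP => [wS|_]; last first.
    by case: ifP => _; [apply: F_local|apply: pinned_local].
  apply: g_local => n [/abw //|nw]; apply/eqP/ab.
  apply: contra wv; move: nw; rewrite !in_ch => /andP[_ /eqP->].
  by case/andP.
have lhsE a : \prod_w factor S w a =
    G a * (g v a * \prod_(u in ch v) F u a).
  rewrite splitE mulrC; congr (_ * (_ * _)); first by rewrite /factor vS.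
  apply: eq_bigr => u uv; rewrite /factor (negPf (chS _ uv)).
  by move: uv; rewrite in_ch => /andP[_ /eqP->]; rewrite vS orbT.
have rootNch : root T \notin ch v by rewrite in_ch eqxx.
have rhsE a : \prod_w factor (S :\ v) w a =
    (pin (ch v) a == a)%:R * (G a * F v a).
  rewrite -prod_pinned // splitE mulrAC mulrC [in RHS](mulrC (G a)).
  congr (_ * (_ * _)).
  - apply: eq_bigr => u uv; rewrite /factor !in_setD1 (negPf (chS _ uv)) andbF.
    by move: uv; rewrite in_ch => /andP[/negPf-> /eqP->]; rewrite eqxx.
  - rewrite /factor !in_setD1 eqxx /=; case: eqP => //= /eqP vroot.
    rewrite S_parent // andbT; case: eqP => // pv.
    (* A nonroot vertex equal to its parent would be its own child, hence outside [S]. *)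
    by have := chS v; rewrite in_ch vroot pv eqxx => /(_ isT); rewrite vS.
  apply: eq_bigr => w /andP[wv]; rewrite in_ch negb_and negbK => wch.
  rewrite /factor !in_setD1 wv /=; case: ifP => // _.
  by case: eqP wch => //= _ ->.
rewrite (eq_bigr _ (fun a _ => lhsE a)) [RHS](eq_bigr _ (fun a _ => rhsE a)).
(* Assignments are grouped by the result of resetting the bonds above the children to [a0]; the
   fibre over a fixed point [c] is the range of the sum in [F_rec] at [c]. *)
rewrite (partition_big (pin (ch v)) (fun c => pin (ch v) c == c)); last first.
  by move=> a _; apply/eqP/ffunP => w; rewrite !ffunE; case: (_ \in _).
rewrite [LHS]big_mkcond; apply: eq_bigr => c _.
case: eqP => [cE|_]; last by rewrite mul0r.
rewrite mul1r F_rec mulr_sumr; apply: eq_big => a.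
  apply/eqP/forall_inP => [<- w wch|ca]; first by rewrite ffunE (negPf wch).
  rewrite -cE; apply/ffunP => w; rewrite !ffunE; case: ifPn => // /ca.
  by move/eqP.
move=> /= /eqP aE; congr (_ * _); apply: G_local.
by apply/forall_inP => w wch; rewrite -aE ffunE (negPf wch).
Qed.

(* The vertices are removed from the expanded set S from the bottom up, starting
   with S = T and ending with S empty. *)
Lemma sum_prod_tree : \sum_a \prod_w g w a = F (root T) a0.
Proof.
have -> : \sum_a \prod_w g w a = \sum_a \prod_w factor [set: T] w a.
  by apply: eq_bigr => a _; apply: eq_bigr => w _; rewrite /factor inE.
have : forall w, w \in [set: T] -> parent w \in [set: T].
  by move=> w; rewrite !inE.
move: [set: T] => S; have [n] := ubnP #|S|; elim: n S => // n IHn S Sn S_parent.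
have [->|/set0Pn[v0 v0S]] := eqVneq S finset.set0; last first.
  (* A deepest vertex of [S] has all its children outside [S]. *)
  pose v := [arg max_(v > v0 in S) depth v]%N.
  have [vS v_max] : v \in S /\ forall w, w \in S -> (depth w <= depth v)%N.
    by rewrite /v; case: arg_maxnP.
  have chS u : u \in ch v -> u \notin S.
    by move=> /depth_ch uv; apply/negP => /v_max; rewrite uv ltnn.
  rewrite (@sum_factorD1 S v) // IHn //.
    by move: Sn; rewrite (cardsD1 v) vS.
  move=> w; rewrite !in_setD1 => /andP[wv wS]; rewrite S_parent // andbT.
  apply/eqP => pw; have := chS w; rewrite in_ch pw eqxx andbT wS.
  case: eqP => [w_root|_ /(_ isT)//] _.
  by move: wv; rewrite -pw w_root parent_root eqxx.
(* With [S] empty, the root carries [F] and every other vertex pins its bond, so only [a0]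
   contributes. *)
rewrite (bigD1 a0) //= [X in _ + X]big1 ?addr0.
  rewrite (bigD1 (root T)) //= big1 ?mulr1; first by rewrite /factor inE eqxx.
  move=> w wr; rewrite /factor !inE (negPf wr) /= /pinned.
  by case: insubP => // m _ _; rewrite eqxx.
move=> a aa0; have [/forallP aP|/forallPn[n0 an]] :=
  boolP [forall w, a w == a0 w].
  by case/eqP: aa0; apply/ffunP => w; apply/eqP/aP.
rewrite (bigD1 (val n0)) //= /factor !inE (negPf (valP n0)) /= /pinned valK.
by rewrite (negPf an) mul0r.
Qed.

End TreeSum.

(** * Case distinctions and products over root, inner vertices and leaves *)

Lemma big_sig_cond (S : Type) (idx : S) (op : Monoid.com_law idx)
    (I : finType) (P Q : pred I) (F : I -> S) :
  \big[op/idx]_(x : {x | P x} | Q (val x)) F (val x)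
  = \big[op/idx]_(x | P x && Q x) F x.
Proof.
rewrite [RHS](reindex_omap (val : {x | P x} -> I) insub) /=; last first.
  by move=> x /andP[Px _]; rewrite insubT.
by apply: eq_bigl => x; rewrite (valP x) valK eqxx andbT.
Qed.

Lemma big_sig (S : Type) (idx : S) (op : Monoid.com_law idx) (I : finType)
    (P : pred I) (F : I -> S) :
  \big[op/idx]_(x : {x | P x}) F (val x) = \big[op/idx]_(x | P x) F x.
Proof.
by rewrite (big_sig_cond _ _ predT); apply: eq_bigl => x; rewrite andbT.
Qed.

(** The value at [x] is chosen as the common transport of the data from all preimages of [x];
    equality proofs in an [eqType] being unique, these transports agree. The resulting equations
    contain no casts. *)
Lemma glue (A B : Type) (X : eqType) (i : A -> X) (k : B -> X) :
    injective i -> injective k -> (forall a b, i a <> k b) ->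
    (forall x, (exists a, i a = x) \/ (exists b, k b = x)) ->
  forall (P : X -> Type) (fa : forall a, P (i a)) (fb : forall b, P (k b)),
  exists f : forall x, P x,
    (forall a, f (i a) = fa a) /\ (forall b, f (k b) = fb b).
Proof.
move=> i_inj k_inj ik cover P fa fb.
have fP x : exists y : P x,
    (forall a (e : i a = x), ecast z (P z) e (fa a) = y) /\
    (forall b (e : k b = x), ecast z (P z) e (fb b) = y).
  have [[a <-]|[b <-]] := cover x.
    exists (fa a); split=> [a' e|b e]; last by case: (ik a b).
    by have aa := i_inj _ _ e; subst a'; rewrite eq_axiomK.
  exists (fb b); split=> [a e|b' e]; first by case: (ik a b).
  by have bb := k_inj _ _ e; subst b'; rewrite eq_axiomK.
exists (fun x => sval (cid (fP x))).
by split=> [a|b]; case: cid => y [/= ya yb]; [rewrite -(ya a erefl)|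
  rewrite -(yb b erefl)].
Qed.

Section Glue.
Variable T : rooted_tree.

Lemma leaf_nonroot_inj : injective (@leaf_nonroot T).
Proof. by move=> l m /(congr1 val) /= /val_inj. Qed.

Lemma nonroot_glue (P : nonroot T -> Type)
    (fl : forall l, P (leaf_nonroot l)) (fi : forall v : inner T, P (val v)) :
  exists f : forall n, P n,
    (forall l, f (leaf_nonroot l) = fl l) /\ (forall v, f (val v) = fi v).
Proof.
apply: glue leaf_nonroot_inj val_inj _ _ P fl fi => [l v lv|n].
  by have := valP v; rewrite -lv /= (valP l).
have [nl|nl] := boolP (is_leaf (val n)).
  by left; exists (exist _ (val n) nl); apply: val_inj.
by right; exists (exist _ n nl).
Qed.

Lemma vertex_glue (P : T -> Type) (fn : forall n : nonroot T, P (val n))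
    (fr : P (root T)) :
  exists f : forall v, P v, (forall n, f (val n) = fn n) /\ f (root T) = fr.
Proof.
have [||n []|v|f [fnE frE]] :=
  @glue _ _ T val (fun _ : unit => root T) _ _ _ _ P fn (fun=> fr).
- exact: val_inj.
- by case=> [] [].
- by move/eqP; rewrite (negPf (valP n)).
- have [->|vr] := eqVneq v (root T); first by right; exists tt.
  by left; exists (exist _ v vr).
by exists f; split=> //; apply: frE tt.
Qed.

Lemma root_not_leaf : ~~ is_leaf (root T).
Proof.
apply/negP => /eqP ch0; have := root_branching T.
by rewrite -/(ch _) ch0 cards0.
Qed.

Lemma prod_vertices (K : comNzRingType) (f : T -> K) :
  \prod_w f w = f (root T) * (\prod_(v : inner T) f (val (val v)))
    * \prod_(l : leaf T) f (val l).
Proof.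
rewrite (bigID (@is_leaf T)) /= mulrC (big_sig _ _ f); congr (_ * _).
rewrite (bigD1 (root T)) ?root_not_leaf //=; congr (_ * _).
rewrite (big_sig _ (fun n : nonroot T => ~~ is_leaf (val n)) (f \o val)) /=.
rewrite (big_sig_cond _ _ (fun w => ~~ is_leaf w)).
by apply: eq_bigl => w; rewrite andbC.
Qed.
End Glue.

(** * Varying only the bonds above the children of one vertex *)

Section Bonds.
Variables (T : rooted_tree) (r : nonroot T -> nat).

Definition extend_bonds (v : T) (a : bonds r) (c : child_bonds r v) : bonds r :=
  [ffun w => match boolP (val w \in ch v) with
             | AltTrue wv => c (exist _ w wv)
             | AltFalse _ => a w
             end].

Lemma extend_bondsK (v : T) (a : bonds r) (c : child_bonds r v) :
  restrict_bonds v (extend_bonds a c) = c.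
Proof.
apply/ffunP => -[w wv]; rewrite !ffunE /=; case: {-}_ / boolP => [wv'|].
  by rewrite (bool_irrelevance wv' wv).
by rewrite wv.
Qed.

Lemma agree_off_extend (v : T) (a : bonds r) (c : child_bonds r v) :
  agree_off (ch v) a (extend_bonds a c).
Proof.
apply/forall_inP => w; rewrite ffunE; case: {-}_ / boolP => // wv.
by rewrite wv.
Qed.

Lemma restrict_bondsK (v : T) (a b : bonds r) :
  agree_off (ch v) a b -> extend_bonds a (restrict_bonds v b) = b.
Proof.
move=> /forall_inP ab; apply/ffunP => w; rewrite ffunE.
by case: {-}_ / boolP => [wv|/ab/eqP//]; rewrite ffunE.
Qed.

(** Extending [a] is a bijection between the two index ranges; this converts the recursion for
    partial contractions into the form of [F_rec]. *)
Lemma sum_child_bonds (K : nmodType) (v : T) (a : bonds r)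
    (f : child_bonds r v -> K) :
  \sum_(b | agree_off (ch v) a b) f (restrict_bonds v b) = \sum_c f c.
Proof.
rewrite (reindex_onto (extend_bonds a) (restrict_bonds v)) /=; last first.
  by move=> b; apply: restrict_bondsK.
apply: eq_big => [c|c _]; last by rewrite extend_bondsK.
by rewrite agree_off_extend extend_bondsK eqxx.
Qed.

Lemma prod_children (K : comNzRingType) (v : T) (f : T -> K) :
  \prod_(u : child v) f (val (val u)) = \prod_(u in ch v) f u.
Proof.
rewrite (big_sig _ (fun u : nonroot T => val u \in ch v) (f \o val)) /=.
rewrite (big_sig_cond _ _ (fun u => u \in ch v)).
by apply: eq_bigl => u; rewrite in_ch andbA andbb.
Qed.

End Bonds.

(** * The recursion computes the full contraction *)

Section Contraction.
Variables (K : fieldType) (T : rooted_tree).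
Variables (d : leaf T -> nat) (r : nonroot T -> nat).

(** Names the only coordinate of a tensor at a leaf: by [descends_leaf] no other leaf lies at or
    below it. *)
Definition self_under (l : leaf T) : leaf_under (val l) :=
  exist _ l (connect0 _ (val l)).

(** At a fixed multi-index [j] this is [sum_prod_tree]: [g] collects the entries of [A], and [F] the
    entries of [phi], or of the root tensor, at the restrictions of [j]. *)
Lemma affine_contractionE (A : affine_parameters K d r)
    (phi : forall n : nonroot T, 'I_(r n) -> W_under K d (val n)) :
    (forall n, 0 < r n)%N ->
    (forall l x i,
      phi (leaf_nonroot l) x i = at_leaf A l (i (self_under l), x)) ->
    (forall (v : inner T) x, phi (val v) x =
      \sum_(c : child_bonds r (val (val v)))
        at_inner A v (c, x) *: pure_tensor (fun u => phi (val u) (c u))) ->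
  affine_contraction A =
    of_root (\sum_(c : child_bonds r (root T))
      at_root A c *: pure_tensor (fun u => phi (val u) (c u))).
Proof.
move=> r_gt0 phi_leaf phi_inner.
set t := \sum_c _; apply/ffunP => j; rewrite !ffunE.
(* Positive ranks provide a base assignment; the value of [F] at the root is the same for all of
   them. *)
pose a0 : bonds r := [ffun n => Ordinal (r_gt0 n)].
have [gn [gn_leaf gn_inner]] := nonroot_glue (P := fun=> bonds r -> K)
  (fun l a => at_leaf A l (j l, a (leaf_nonroot l)))
  (fun v a => at_inner A v (restrict_bonds (val (val v)) a, a (val v))).
have [g [g_nonroot g_root]] := vertex_glue (P := fun=> bonds r -> K)
  gn (fun a => at_root A (restrict_bonds (root T) a)).
have [F [F_nonroot F_root]] := vertex_glue (P := fun=> bonds r -> K)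
  (fun n a => phi n (a n) (restrict (val n) j))
  (fun=> t (restrict (root T) j)).
have pureE (v : T) (b : bonds r) :
    pure_tensor (fun u : child v => phi (val u) (restrict_bonds v b u))
      (restrict v j) = \prod_(u in ch v) F u b.
  rewrite ffunE -prod_children; apply: eq_bigr => u _.
  rewrite F_nonroot !ffunE; congr (phi _ _ _).
  by apply/ffunP => l; rewrite !ffunE.
have FE (v : T) (a : bonds r) (f : child_bonds r v -> K) :
  (\sum_c f c *: pure_tensor (fun u : child v => phi (val u) (c u)))
    (restrict v j) =
  \sum_(b | agree_off (ch v) a b)
    f (restrict_bonds v b) * \prod_(u in ch v) F u b.
  rewrite sum_ffunE -(sum_child_bonds a); apply: eq_bigr => b _.
  by rewrite ffunE pureE.
have <- : F (root T) a0 = t (restrict (root T) j) by rewrite F_root.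
have vP (v : T) : v = root T \/ exists n : nonroot T, v = val n.
  have [->|vr] := eqVneq v (root T); [by left|right].
  by exists (exist _ v vr).
rewrite -(@sum_prod_tree _ _ _ g).
- apply: eq_bigr => a _; rewrite prod_vertices g_root.
  congr (_ * _ * _); apply: eq_bigr => x _.
    by rewrite (g_nonroot (val x)) gn_inner.
  by rewrite (g_nonroot (leaf_nonroot x)) gn_leaf.
- move=> v a b; have [->|[n ->] ab] := vP v; first by rewrite F_root.
  by rewrite F_nonroot ab.
- move=> v a b; have [->|[n ->]] := vP v => ab.
    rewrite g_root; congr (at_root A _); apply/ffunP => u; rewrite !ffunE.
    by apply: ab; right; apply: valP u.
  rewrite g_nonroot; have [nl|nl] := boolP (is_leaf (val n)).
    have -> : n = leaf_nonroot (exist _ (val n) nl) by apply: val_inj.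
    by rewrite !gn_leaf ab //; left.
  have -> : n = val (exist _ n nl : inner T) by [].
  rewrite !gn_inner ab; last by left.
  congr (at_inner A _ (_, _)); apply/ffunP => u; rewrite !ffunE.
  by apply: ab; right; apply: valP u.
- move=> v a; have [->|[n ->]] := vP v.
    by rewrite F_root (FE _ a); apply: eq_bigr => b _; rewrite g_root.
  rewrite F_nonroot; have [nl|nl] := boolP (is_leaf (val n)); last first.
    have -> : n = val (exist _ n nl : inner T) by [].
    rewrite phi_inner (FE _ a (fun c => at_inner A _ (c, _))).
    apply: eq_bigr => b /forall_inP ab; rewrite g_nonroot gn_inner.
    (* By depth, a vertex is not among its children, so [a] and [b] agree on the bond above it. *)
    rewrite (eqP (ab _ _)) //; apply/negP => /depth_ch/eqP.
    by rewrite eqn_leq ltnn andbF.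
  rewrite (eq_bigl (pred1 a)) => [|b]; last first.
    rewrite /agree_off (eqP nl); apply/forall_inP/eqP => [ab|-> w _];
      last exact: eqxx.
    by apply/ffunP => w; apply/esym/eqP/ab; rewrite inE.
  rewrite big_pred1_eq (eqP nl) big_set0 mulr1 g_nonroot.
  have -> : n = leaf_nonroot (exist _ (val n) nl) by apply: val_inj.
  by rewrite phi_leaf gn_leaf ffunE.
Qed.

End Contraction.

(** * Contractions lie in the tree tensor network variety *)

Lemma span_imageP (K : fieldType) (V : vectType K) (I : finType) (f : I -> V)
    (u : V) :
  u \in <<[seq f i | i : I]>>%VS -> exists c : I -> K, u = \sum_i c i *: f i.
Proof.
rewrite span_def big_image /= => /memv_sumP[us usP ->].
have /choice[c cP] i : exists k, us i = k *: f i by apply/vlineP/usP.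
by exists c; apply: eq_bigr => i _; apply: cP.
Qed.

Section ImageSubTTN.
Variables (K : fieldType) (T : rooted_tree).
Variables (d : leaf T -> nat) (r : nonroot T -> nat).

Lemma eq_pure_tensor (v : T)
    (s t : forall u : child v, W_under K d (val (val u))) :
  (forall u, s u = t u) -> pure_tensor s = pure_tensor t.
Proof.
move=> st; apply/ffunP => j; rewrite !ffunE; apply: eq_bigr => u _.
by rewrite st.
Qed.

Lemma partial_contractions (A : affine_parameters K d r) :
  exists phi : forall n : nonroot T, 'I_(r n) -> W_under K d (val n),
    (forall l x i,
      phi (leaf_nonroot l) x i = at_leaf A l (i (self_under l), x)) /\
    (forall (v : inner T) x, phi (val v) x =
      \sum_(c : child_bonds r (val (val v)))
        at_inner A v (c, x) *: pure_tensor (fun u => phi (val u) (c u))).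
Proof.
pose family := forall n : nonroot T, 'I_(r n) -> W_under K d (val n).
have /choice[step stepP] (phi : family) : exists phi' : family,
    (forall l x, phi' (leaf_nonroot l) x =
       [ffun i : index_under d (val l) => at_leaf A l (i (self_under l), x)]) /\
    (forall (v : inner T) x, phi' (val v) x =
      \sum_(c : child_bonds r (val (val v)))
        at_inner A v (c, x) *: pure_tensor (fun u => phi (val u) (c u))).
  have [phi' [leafE innerE]] := nonroot_glue
    (P := fun n => 'I_(r n) -> W_under K d (val n))
    (fun l x => [ffun i : index_under d (val l) =>
       at_leaf A l (i (self_under l), x)])
    (fun v x => \sum_(c : child_bonds r (val (val v)))
       at_inner A v (c, x) *: pure_tensor (fun u => phi (val u) (c u))).
  by exists phi'; split=> [l|v] x; rewrite ?leafE ?innerE.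
(* The recursion is a fixed point of step, and iterating step reaches it after
   as many steps as the tree is deep. *)
pose iterate k : family := iter k step (fun _ _ => 0).
pose N := (\max_(v : T) depth v)%N.
have stable k (n : nonroot T) x : (N < k + depth (val n))%N ->
    iterate k.+1 n x = iterate k n x.
  elim: k n x => [|k IHk] n x.
    by rewrite add0n ltnNge (@leq_bigmax _ (@depth T) (val n)).
  move=> Nk; have [nl|nl] := boolP (is_leaf (val n)).
    have nE : n = leaf_nonroot (exist _ (val n) nl) by apply: val_inj.
    move: x; rewrite nE => x.
    by rewrite /iterate !iterS (stepP _).1 (stepP _).1.
  have nE : n = val (exist _ n nl : inner T) by [].
  move: x; rewrite nE => x.
  rewrite /iterate !iterS !(stepP _).2 -!iterS; apply: eq_bigr => c _.
  congr (_ *: _); apply: eq_pure_tensor => u; apply: IHk.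
  by rewrite (depth_ch (valP u)) addnS.
(* Children have positive depth, so [stable] says that they are already settled after [N] steps. *)
exists (iterate N.+1); split=> [l x i|v x].
  by rewrite /iterate iterS (stepP _).1 ffunE.
rewrite {1}/iterate iterS (stepP _).2; apply: eq_bigr => c _.
congr (_ *: _); apply: eq_pure_tensor => u; rewrite stable //.
by rewrite (depth_ch (valP u)) addnS ltnS leq_addr.
Qed.

(** The sums in [in_tensor_product] carry no coefficients, so a scalar has to be absorbed into the
    factor at one chosen child. *)
Lemma pure_tensorZ (v : T) (u0 : child v) (k : K)
    (t : forall u : child v, W_under K d (val (val u))) :
  pure_tensor (fun u => (if u == u0 then k else 1) *: t u)
  = k *: pure_tensor t.
Proof.
apply/ffunP => j; rewrite !ffunE (bigD1 u0) //= [in RHS](bigD1 u0) //= eqxx.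
rewrite ffunE -mulrA; congr (_ * (_ * _)); apply: eq_bigr => u /negPf->.
by rewrite scale1r.
Qed.

Lemma has_child (v : T) : ~~ is_leaf v -> exists u : child v, True.
Proof.
move=> /set0Pn[w wv]; have := wv; rewrite in_ch => /andP[wr _].
by exists (exist _ (exist _ w wr) wv).
Qed.

Lemma sum_in_tensor_product (U : forall v : T, {vspace W_under K d v}) (v : T)
    (I : finType) (k : I -> K)
    (t : I -> forall u : child v, W_under K d (val (val u))) :
    ~~ is_leaf v -> (forall i u, t i u \in U (val (val u))) ->
  in_tensor_product U (\sum_i k i *: pure_tensor (t i)).
Proof.
move=> /has_child[u0 _] tU.
exists #|I|, (fun i u =>
  (if u == u0 then k (enum_val i) else 1) *: t (enum_val i) u); split.
  by move=> i u; apply: memvZ.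
rewrite (reindex (@enum_val I (pred_of_argType I))) /=;
  last exact/onW_bij/enum_val_bij.
by apply: eq_bigr => i _; rewrite pure_tensorZ.
Qed.

Lemma contraction_image_sub_TTN :
  (forall n, 0 < r n)%N -> (contraction_image K d r `<=` TTN K d r)%classic.
Proof.
move=> r_gt0 p [a]; rewrite /contraction; set A := representative a.
case: insubP => // q psi_dim psi_line [<-].
have [phi [phi_leaf phi_inner]] := partial_contractions A.
have AE := affine_contractionE r_gt0 phi_leaf phi_inner.
set t := \sum_c _ in AE.
have [U [U_nonroot U_root]] := vertex_glue
  (P := fun v => {vspace W_under K d v})
  (fun n => <<[seq phi n x | x : 'I_(r n)]>>%VS)
  (@vline K (W_under K d (root T)) t).
have phiU n x : phi n x \in U (val n).
  by rewrite U_nonroot memv_span // map_f // mem_enum.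
exists U; split.
- move=> v; have [->|vr] := eqVneq v (root T).
    by rewrite U_root dim_vline /rank insubN ?negbK // leq_b1.
  rewrite -[v]/(val (exist _ v vr : nonroot T)) U_nonroot /rank valK /=.
  by rewrite (leq_trans (dim_span _)) // size_map -cardE card_ord.
- move=> v v_inner w.
  have [vroot|vr] := eqVneq v (root T).
    move: w v_inner; rewrite vroot => w v_inner.
    rewrite U_root => /vlineP[k ->]; rewrite /t scaler_sumr.
    rewrite (eq_bigr _ (fun c _ => scalerA _ _ _)).
    by apply: sum_in_tensor_product => // c u; apply: phiU.
  pose n : nonroot T := exist _ v vr; pose n' : inner T := exist _ n v_inner.
  rewrite -[v]/(val n) U_nonroot => /span_imageP[k ->].
  rewrite (eq_bigr _ (fun x _ => congr1 ( *:%R (k x)) (phi_inner n' x))).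
  rewrite (eq_bigr _ (fun x _ => scaler_sumr _ _ _ _)) exchange_big /=.
  rewrite (eq_bigr (fun c => (\sum_x k x * at_inner A n' (c, x)) *:
    pure_tensor (fun u : child v => phi (val u) (c u)))).
    by apply: sum_in_tensor_product => // c u; apply: phiU.
  move=> c _; rewrite scaler_suml; apply: eq_bigr => x _; exact: scalerA.
exists (affine_contraction A); split=> //.
(* The rational map is defined at [a], so the line has dimension one and the contraction is
   nonzero. *)
- by apply: contraTneq psi_dim => ->; rewrite dim_vline eqxx.
- by exists t => //; rewrite U_root memv_line.
Qed.

End ImageSubTTN.

(** * Points of the variety are contractions *)

(** Distributivity is applied over the tagged union of the [J i], after which the choice functions
    are turned back into dependent ones. *)
Lemma prod_sum_dffun (K : comNzRingType) (I : finType) (J : I -> finType)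
    (F : forall i, J i -> K) :
  \prod_i \sum_(x : J i) F i x
  = \sum_(f : {dffun forall i, J i}) \prod_i F i (f i).
Proof.
pose P i := [ffun x => F i x].
rewrite (eq_bigr (fun i => \sum_(x : J i) P i x)) => [|i _]; last first.
  by apply: eq_bigr => x _; rewrite ffunE.
rewrite (eq_bigr _ (fun i _ => big_tag P i)) bigA_distr_big_dep.
rewrite -(big_fprod _ _ P).
rewrite [RHS](reindex (@dffun_of_fprod _ J)) /=; last first.
  exact/onW_bij/dffun_of_fprod_bij.
by apply: eq_bigr => f _; apply: eq_bigr => i _; rewrite !ffunE.
Qed.

(** The default value [0] of [nth] pads a basis of [U] to [m] vectors, since the dimension may be
    smaller than the rank. *)
Lemma vbasis_coef (K : fieldType) (V : vectType K) (U : {vspace V}) (m : nat)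
    (u : V) :
    (\dim U <= m)%N -> u \in U ->
  exists c : 'I_m -> K, u = \sum_x c x *: (vbasis U)`_x.
Proof.
move=> Um uU; apply: span_imageP; rewrite -(span_basis (vbasisP U)) in uU.
apply: subvP uU; apply: sub_span => w wU; apply/mapP.
have iU : (index w (vbasis U) < \dim U)%N.
  by rewrite -[X in (_ < X)%N](size_tuple (vbasis U)) index_mem.
by exists (Ordinal (leq_trans iU Um)); rewrite ?mem_enum //= nth_index.
Qed.

Section TTNSubImage.
Variables (K : fieldType) (T : rooted_tree).
Variables (d : leaf T -> nat) (r : nonroot T -> nat).

Lemma pure_tensor_sum (v : T)
    (phi : forall n : nonroot T, 'I_(r n) -> W_under K d (val n))
    (k : forall u : child v, 'I_(r (val u)) -> K) :
  pure_tensor (fun u : child v => \sum_x k u x *: phi (val u) x)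
  = \sum_(c : child_bonds r v)
      (\prod_u k u (c u)) *: pure_tensor (fun u => phi (val u) (c u)).
Proof.
apply/ffunP => j; rewrite ffunE sum_ffunE.
pose f (u : child v) x := k u x * phi (val u) x (restrict_child u j).
rewrite (eq_bigr (fun u => \sum_x f u x)) => [|u _]; last first.
  by rewrite sum_ffunE; apply: eq_bigr => x _; rewrite ffunE.
rewrite prod_sum_dffun; apply: eq_bigr => c _.
by rewrite !ffunE [LHS]big_split.
Qed.

(** Each factor is expanded in the [phi]; by multilinearity the coefficient at [c] sums, over the
    pure tensors, the products of the coordinates selected by [c]. *)
Lemma in_tensor_product_coef (U : forall v : T, {vspace W_under K d v}) (v : T)
    (phi : forall n : nonroot T, 'I_(r n) -> W_under K d (val n))
    (w : W_under K d v) :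
    (forall (n : nonroot T) u, u \in U (val n) ->
      exists k : 'I_(r n) -> K, u = \sum_x k x *: phi n x) ->
    in_tensor_product U w ->
  exists k : tensor K (child_bonds r v),
    w = \sum_c k c *: pure_tensor (fun u : child v => phi (val u) (c u)).
Proof.
move=> spanU [n [t [tU ->]]].
have kP i (u : child v) :
    exists k : 'I_(r (val u)) -> K, t i u = \sum_x k x *: phi (val u) x.
  exact/spanU/tU.
pose k i u := sval (cid (kP i u)).
exists [ffun c : child_bonds r v => \sum_i \prod_u k i u (c u)].
rewrite (eq_bigr (fun i => pure_tensor
  (fun u : child v => \sum_x k i u x *: phi (val u) x))) => [|i _]; last first.
  by apply: eq_pure_tensor => u; rewrite /k; case: cid.
rewrite (eq_bigr _ (fun i _ => pure_tensor_sum _ _)) exchange_big /=.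
by apply: eq_bigr => c _; rewrite ffunE scaler_suml.
Qed.

(** Otherwise the last vertex before the leaf on the path of parents would be a child of the leaf,
    or the root, whose parent is itself; a leaf has no child and is not the root. *)
Lemma descends_leaf (l : leaf T) (x : T) : descends x (val l) -> x = val l.
Proof.
move=> /iter_findex; case: (findex _ _ _) => [//|k]; rewrite iterS.
set y := iter k _ x => yl.
have := valP l; rewrite /is_leaf => /eqP ch0.
have : y \notin ch (val l) by rewrite ch0 inE.
rewrite in_ch yl eqxx andbT negbK => /eqP y_root.
by case/negP: (leaf_neq_root l); rewrite -yl y_root parent_root.
Qed.

Lemma index_under_leaf_inj (l : leaf T) (i j : index_under d (val l)) :
  i (self_under l) = j (self_under l) -> i = j.
Proof.
move=> ij; apply/ffunP => m; have -> // : m = self_under l.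
by apply/val_inj/val_inj/descends_leaf/(valP m).
Qed.

(** A vanishing local tensor is [0] times itself, and multihomogeneity pulls this [0] out of the
    contraction. Hence the local tensors built below define projective points. *)
Lemma affine_contraction_neq0 (A : affine_parameters K d r) :
    affine_contraction A != 0 ->
  [/\ forall l, at_leaf A l != 0, forall v, at_inner A v != 0 & at_root A != 0].
Proof.
have scale0 (I : finType) (V : I -> vectType K) (f : forall i, V i) i0 :
    f i0 = 0 -> forall i, f i = (i != i0)%:R *: f i.
  by move=> f0 i; case: eqP => [->|_]; rewrite ?f0 ?scaler0 ?scale1r.
have one (I : finType) (V : I -> vectType K) (f : forall i, V i) i :
    f i = (fun=> 1) i *: f i by rewrite scale1r.
move=> A0; split=> [l|v|]; apply: contraNneq A0 => A0.
- rewrite (affine_contraction_scale (scale0 _ _ (at_leaf A) l A0)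
    (one _ _ (at_inner A)) (esym (scale1r _))).
  by rewrite [X in _ * X](bigD1 l) //= eqxx mul0r mulr0 scale0r.
- rewrite (affine_contraction_scale (one _ _ (at_leaf A))
    (scale0 _ _ (at_inner A) v A0) (esym (scale1r _))).
  by rewrite (bigD1 v) //= eqxx mul0r mulr0 mul0r scale0r.
have root0 : at_root A = 0 *: at_root A by rewrite scale0r.
rewrite (affine_contraction_scale (one _ _ (at_leaf A))
  (one _ _ (at_inner A)) root0).
by rewrite !mul0r scale0r.
Qed.

Lemma dim_line (V : vectType K) (x : V) : x != 0 -> \dim <[x]> == 1%N.
Proof. by move=> x0; rewrite dim_vline x0. Qed.

Definition line (V : vectType K) (x : V) (x0 : x != 0) : projective V :=
  exist _ <[x]>%VS (dim_line x0).

Lemma TTN_sub_contraction_image :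
  (forall n, 0 < r n)%N -> (TTN K d r `<=` contraction_image K d r)%classic.
Proof.
move=> r_gt0 p [U [dimU tensorU [psi [psi0 p_psi [t tU psi_t]]]]].
pose phi (n : nonroot T) (x : 'I_(r n)) := (vbasis (U (val n)))`_x.
have spanU (n : nonroot T) u : u \in U (val n) ->
    exists k : 'I_(r n) -> K, u = \sum_x k x *: phi n x.
  by apply: vbasis_coef; have := dimU (val n); rewrite /rank valK.
have phiU n x : phi n x \in U (val n).
  have [xU|Ux] := ltnP x (\dim (U (val n))).
    by rewrite vbasis_mem // mem_nth // size_tuple.
  (* The padding vectors are zero, hence in the subspace. *)
  by rewrite /phi nth_default ?mem0v // size_tuple.
have innerP (v : inner T) (x : 'I_(r (val v))) :
    exists k : tensor K (child_bonds r (val (val v))), phi (val v) x =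
      \sum_c k c *: pure_tensor (fun u => phi (val u) (c u)).
  apply: in_tensor_product_coef spanU _; apply: tensorU (phiU _ _).
  exact: valP v.
have [k tE] := in_tensor_product_coef spanU
  (tensorU _ (root_not_leaf T) _ tU).
pose A : affine_parameters K d r := ParameterFamily (F := fun V => V)
  (fun l => [ffun p : 'I_(d l) * 'I_(r (leaf_nonroot l)) =>
     (* At most one multi-index has coordinate [p.1]; summing avoids building it explicitly in its
        dependent type. *)
     \sum_(i : index_under d (val l) | i (self_under l) == p.1)
       phi (leaf_nonroot l) p.2 i])
  (fun v => [ffun p : child_bonds r (val (val v)) * 'I_(r (val v)) =>
     sval (cid (innerP v p.2)) p.1])
  k.
have AE : affine_contraction A = psi.
  rewrite psi_t tE; apply: affine_contractionE => // [l x i|v x].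
    rewrite ffunE (big_pred1 i) // => j /=.
    by apply/eqP/eqP => [/index_under_leaf_inj|->].
  rewrite [LHS](svalP (cid (innerP v x))).
  by apply: eq_bigr => c _; rewrite ffunE.
have [|Al Ai Ar] := affine_contraction_neq0 (A := A); first by rewrite AE.
exists (ParameterFamily (F := fun V => projective V)
  (fun l => line (Al l)) (fun v => line (Ai v)) (line Ar)).
rewrite (contractionE (A := A)) // AE -p_psi; exact: valK.
Qed.

End TTNSubImage.

Theorem proposition2p5 (R : realType) (T : rooted_tree)
    (d : leaf T -> nat) (r : nonroot T -> nat) :
  admissible d r ->
  TTN R[i] d r = contraction_image R[i] d r.
Proof.
case=> r_gt0 _ _; apply/seteqP.
by split; [apply: TTN_sub_contraction_image|apply: contraction_image_sub_TTN].
Qed.
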